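(* Let $(G,C,C^\vee)$ be an exact framework for $B$ and let $\mathcal{A}_0(B)$ be the cluster algebra with principal coefficients and initial exchange matrix $B$. Then the map $v\mapsto\operatorname{Seed}(v)$ induced on vertices of $G$ is a graph isomorphism from $G$ (ignoring half-edges) onto its image, a subgraph of the exchange graph $\mathrm{Ex}_0(B)$. If $(G,C,C^\vee)$ is moreover complete, this map is a graph isomorphism from $G$ to $\mathrm{Ex}_0(B)$.
   Context: Setting: $I$ finite, $|I|=n$; $B=[b_{ij}]$ skew-symmetrizable integer matrix ($\delta(i)b_{ij}=-\delta(j)b_{ji}$, $\delta>0$); $V$ with basis of simple roots $\{\alpha_i\}$, simple co-roots $\alpha_i^\vee=\delta(i)^{-1}\alpha_i$; $\omega(\alpha_i^\vee,\alpha_j)=b_{ij}$; $[x]_+=\max(x,0)$. Framework: quasi-graphs are simple hypergraphs with half-edges (size 1) and full edges (size 2); degree counts all edges; connected = connected after removing half-edges; $I(v)$ = edges at $v$. A framework for $B$ is $(G,C,C^\vee)$, $G$ connected and $n$-regular, with $C(v,e),C^\vee(v,e)\in V$ ($\beta^\vee:=C^\vee(v,e)$ for $\beta=C(v,e)$) such that: $C^\vee(v,e)$ is a positive multiple of $C(v,e)$; $C(v,e)\ne0$ and $\pm C(v,e)$ is in the nonnegative span of simple roots (giving $\operatorname{sgn}\in\{\pm1\}$, same for co-label); some vertex $v_b$ has $C(v_b)=\{\alpha_i\}$, $C^\vee(v_b)=\{\alpha_i^\vee\}$ (identifying $I(v_b)$ with $I$); for distinct $v,v'$ on an edge $e$: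 $C(v',e)=-C(v,e)$, $C^\vee(v',e)=-C^\vee(v,e)$, and for $\beta=C(v,e)$, $\gamma\in C(v)\setminus\{\beta\}$, $\gamma+[\operatorname{sgn}(\beta)\omega(\beta^\vee,\gamma)]_+\beta\in C(v')$ and $\gamma^\vee+[-\operatorname{sgn}(\beta^\vee)\omega(\gamma^\vee,\beta)]_+\beta^\vee\in C^\vee(v')$. For a full edge $e$ joining $v,v'$, $\mu_e:I(v)\to I(v')$ has $\mu_e(e)=e$ and for $f\ne e$, $\mu_e(f)$ is the $f'$ with $C(v',f')=C(v,f)+[\operatorname{sgn}(C(v,e))\omega(C^\vee(v,e),C(v,f))]_+C(v,e)$. Complete: $G$ has no half-edges. Universal cover $\hat G$: vertices are sequences $(u_0,\dots,u_k)$ with $u_0=v_b$, consecutive $u_{i-1},u_i$ joined by an edge $e_i$ of $G$, $e_i\ne e_{i+1}$; $(u_0,\dots,u_k)$ joined to $(u_0,\dots,u_{k-1})$ over $e_k$; covering map $p(u_0,\dots,u_k)=u_k$. $\mathcal{A}_0(B)$: initial cluster $(x_i)$, frozen $(y_i)$, extended exchange matrix $\binom{B}{\mathrm{Id}}$; mutation at $k$: $\tilde b'_{pq}=-\tilde b_{pq}$ if $p=k$ or $q=k$, else $\tilde b_{pq}+\operatorname{sgn}(\tilde b_{pk})[\tilde b_{pk}\tilde b_{kq}]_+$; $x_k\mapsto x_k^{-1}(\prod_pz_p^{[\tilde b_{pk}]_+}+\prod_pz_p^{[-\tilde b_{pk}]_+})$ ($z_p$ the variable of row $p$). $\operatorname{Seed}(u_0,\dots,u_k)$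 is obtained from the initial seed by successive mutations at $e_1,\dots,e_k$, indices transported via $\mu_{e_j}$. $\mathrm{Ex}_0(B)$ is the exchange graph: vertices are seeds reachable from the initial seed, up to simultaneous relabeling of indices, edges are single mutations. The framework is ample if $\operatorname{Seed}(\tilde v)$ (as a vertex of $\mathrm{Ex}_0(B)$) depends only on $p(\tilde v)$, so that $\operatorname{Seed}$ descends to vertices of $G$; it is injective if for all vertices $u,v$ of $G$ the conditions $C(u)=C(v)$, $C^\vee(u)=C^\vee(v)$, $u=v$ are equivalent; it is exact if it is injective and ample. *)

(* Defs.v *)
From HB Require Import structures.
From mathcomp Require Import all_boot all_order all_fingroup all_algebra.
From mathcomp Require Import generic_quotient fraction finmap mpoly.

Set Implicit Arguments.
Unset Strict Implicit.
Unset Printing Implicit Defensive.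

Import Order.TTheory GRing.Theory Num.Theory.

Local Open Scope ring_scope.
Local Open Scope quotient_scope.

Definition pospart (R : realDomainType) (x : R) : R := Num.max x 0.

Definition skew_symmetrizer (R : realFieldType) (I : finType)
    (B : I -> I -> int) (delta : I -> R) : Prop :=
  (forall i, 0 < delta i) /\
  (forall i j, delta i * (B i j)%:~R = - (delta j * (B j i)%:~R)).

Record graph (T : Type) := Graph {
  gvertex : T -> Prop;
  gedge : T -> T -> Prop }.

Definition subgraph (T : Type) (G H : graph T) : Prop :=
  (forall u, gvertex G u -> gvertex H u) /\
  (forall u v, gedge G u v -> gedge H u v).

(* The image has only the images of the edges of G: in general it is not an
   induced subgraph. *)
Definition graph_image (T U : Type) (f : T -> U) (G : graph T) : graph U :=
  Graph (fun x => exists2 u, gvertex G u & x = f u)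
        (fun x y => exists u v, [/\ gedge G u v, x = f u & y = f v]).

Definition graph_iso (T U : Type) (f : T -> U) (G : graph T) (H : graph U) :
    Prop :=
  [/\ forall u, gvertex G u -> gvertex H (f u),
      forall u v, gvertex G u -> gvertex G v -> f u = f v -> u = v,
      forall x, gvertex H x -> exists2 u, gvertex G u & f u = x &
      forall u v, gvertex G u -> gvertex G v ->
        (gedge G u v <-> gedge H (f u) (f v))].

(* [inc v] is the set of edges at [v].  Simplicity bears on full edges only: a
   vertex may carry several half-edges. *)
Record quasi_graph := QuasiGraph {
  qvert : choiceType;
  qedge : choiceType;
  inc : qvert -> {fset qedge};
  edge_inhabited : forall e, exists v, e \in inc v;
  edge_size_le2 : forall e u v w,
    e \in inc u -> e \in inc v -> e \in inc w -> [|| u == v, v == w | u == w];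
  full_edge_uniq : forall e f u v, u != v ->
    e \in inc u -> e \in inc v -> f \in inc u -> f \in inc v -> e = f }.

Section QuasiGraph.
Variable G : quasi_graph.
Implicit Types (e : qedge G) (u v : qvert G).

Definition joins e u v : bool := [&& u != v, e \in inc u & e \in inc v].

Definition edge_of u v : option (qedge G) :=
  omap val [pick e : inc u | joins (val e) u v].

Definition adj : rel (qvert G) := [rel u v | isSome (edge_of u v)].

Definition full_graph : graph (qvert G) := Graph (fun=> True) adj.

Definition qconnected : Prop :=
  forall u v, exists2 p, path adj u p & last u p = v.

Definition qregular (n : nat) : Prop := forall v, #|` inc v| = n.

Definition no_half_edge : Prop :=
  forall v e, e \in inc v -> exists v', joins e v v'.

(* The vertex (u_0, ..., u_k) of the universal cover, with u_0 = vb, is encoded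
   by the sequence [:: u_1; ...; u_k]. *)
Definition cover_vertex (vb : qvert G) (p : seq (qvert G)) : bool :=
  path adj vb p && sorted (fun a b => a != b) (pairmap edge_of vb p).

Lemma adjP u v : reflect (exists e, joins e u v) (adj u v).
Proof.
rewrite /adj /edge_of /=; case: pickP => [e je|no_e] /=; constructor.
  by exists (val e).
case=> e je; have /and3P[_ eu _] := je.
by have := no_e [` eu]%fset; rewrite je.
Qed.

Lemma edge_of_joins e u v : edge_of u v = Some e -> joins e u v.
Proof. by rewrite /edge_of; case: pickP => // f jf [<-]. Qed.

Lemma uniq_cover_vertex vb p :
  path adj vb p -> uniq (vb :: p) -> cover_vertex vb p.
Proof.
rewrite /cover_vertex => pp up; rewrite pp /=.
elim: p vb pp up => [//|u [//|v p] IHp] vb /andP[vb_u pu] /andP[vbNp up].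
have /= -> := IHp u pu up; rewrite andbT; apply/eqP => Eq.
move: vb_u; rewrite /adj /=; case Ef: (edge_of vb u) => [e|//] _.
have /and3P[vbu evb eu] := edge_of_joins Ef.
have /and3P[uv _ ev] : joins e u v by apply: edge_of_joins; rewrite -Eq.
have := edge_size_le2 evb eu ev.
move: vbNp; rewrite !inE !negb_or => /and3P[_ vbv _].
by rewrite (negbTE vbu) (negbTE uv) (negbTE vbv).
Qed.

Lemma cover_surj vb : qconnected ->
  forall v, exists p, cover_vertex vb p && (last vb p == v).
Proof.
move=> conn v; have [p pp <-] := conn vb v.
case: (shortenP pp) => q pq uq _.
by exists q; rewrite eqxx andbT; apply: uniq_cover_vertex.
Qed.

End QuasiGraph.

Section Seeds.
Variables (I : finType) (B : I -> I -> int).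

(* The rows of an extended exchange matrix are indexed by [I + I]: [inl i] is
   the row of the i-th cluster variable, [inr i] that of the frozen y_i.  The
   same type indexes the 2n generators of the ambient field. *)
Definition ambient : fieldType := {fraction {mpoly rat[#|{: I + I}|]}}.

Definition gen (p : I + I) : ambient := FracField.tofrac 'X_(enum_rank p).

Definition seed : choiceType :=
  ({ffun I -> ambient} * {ffun (I + I) * I -> int})%type.

Implicit Types (S : seed) (k : I) (s : {perm I}).

Definition cluster S i : ambient := S.1 i.
Definition exmx S (p : I + I) (q : I) : int := S.2 (p, q).

Definition seedvar S (p : I + I) : ambient :=
  match p with inl i => cluster S i | inr i => gen (inr i) end.

Definition mutate S k : seed :=
  ([ffun i => if i == k then
      (cluster S k)^-1 *
      (\prod_p seedvar S p ^ pospart (exmx S p k) +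
       \prod_p seedvar S p ^ pospart (- exmx S p k))
    else cluster S i],
   [ffun pq => let: (p, q) := pq in
    if (p == inl k) || (q == k) then - exmx S p q
    else exmx S p q +
         Num.sg (exmx S p k) * pospart (exmx S p k * exmx S (inl k) q)]).

Definition init_seed : seed :=
  ([ffun i => gen (inl i)],
   [ffun pq => match pq with
               | (inl i, j) => B i j
               | (inr i, j) => (i == j)%:Z
               end]).

Definition relabel_row s (p : I + I) : I + I :=
  match p with inl i => inl (s i) | inr i => inr i end.

Definition relabel s S : seed :=
  ([ffun i => cluster S (s i)],
   [ffun pq => exmx S (relabel_row s pq.1) (s pq.2)]).

Definition seed_equiv S S' : bool := [exists s, S' == relabel s S].

Lemma relabel1 S : relabel 1%g S = S.
Proof.
case: S => x b; rewrite /relabel /cluster /exmx /=; congr (_, _).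
  by apply/ffunP => i; rewrite ffunE perm1.
by apply/ffunP => -[[i|i] j]; rewrite ffunE /= !perm1.
Qed.

Lemma relabelM s s' S : relabel (s * s')%g S = relabel s (relabel s' S).
Proof.
rewrite /relabel /cluster /exmx /=; congr (_, _).
  by apply/ffunP => i; rewrite !ffunE permM.
by apply/ffunP => -[[i|i] j]; rewrite !ffunE /= !permM.
Qed.

Lemma seed_equiv_refl : reflexive seed_equiv.
Proof. by move=> S; apply/existsP; exists 1%g; rewrite relabel1. Qed.

Lemma seed_equiv_sym : ssrbool.symmetric seed_equiv.
Proof.
move=> S S'; apply/existsP/existsP => -[s /eqP->];
  by exists s^-1%g; rewrite -relabelM mulVg relabel1.
Qed.

Lemma seed_equiv_trans : transitive seed_equiv.
Proof.
move=> S' S S'' /existsP[s /eqP->] /existsP[s' /eqP->].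
by apply/existsP; exists (s' * s)%g; rewrite relabelM.
Qed.

Canonical seed_equiv_rel :=
  EquivRel seed_equiv seed_equiv_refl seed_equiv_sym seed_equiv_trans.

Definition unlabeled_seed := {eq_quot seed_equiv_rel}.

Definition unlabel S : unlabeled_seed := \pi_unlabeled_seed S.

Lemma unlabelP S S' : reflect (unlabel S = unlabel S') (seed_equiv S S').
Proof.
by apply: (iffP idP) => [h|]; [apply/eqmodP|move/eqmodP].
Qed.

Definition reachable S : Prop := exists ks : seq I, S = foldl mutate init_seed ks.

Definition exchange_graph : graph unlabeled_seed :=
  Graph
    (fun x => exists2 S, reachable S & x = unlabel S)
    (fun x y => exists S k,
       [/\ reachable S, x = unlabel S & y = unlabel (mutate S k)]).

End Seeds.

Section RootSpace.
Variables (R : realFieldType) (I : finType) (B : I -> I -> int) (delta : I -> R).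

(* V is presented by coordinates with respect to the simple roots. *)
Definition rootspace : lmodType R := {ffun I -> R^o}.

Implicit Types x y : rootspace.

Definition coef x (i : I) : R := (x : {ffun I -> R^o}) i.

Definition sroot (i : I) : rootspace := [ffun j => ((i == j)%:R : R)].

Definition scoroot (i : I) : rootspace := (delta i)^-1 *: sroot i.

(* omega(alpha_i, alpha_j) = delta(i) b_ij, see [omegaE]. *)
Definition omega x y : R :=
  \sum_i \sum_j delta i * (B i j)%:~R * coef x i * coef y j.

Definition nonneg x : bool := [forall i, 0 <= coef x i].

(* Meaningful only when x is nonzero and one of x, - x is nonnegative. *)
Definition vsgn x : R := if nonneg x then 1 else -1.

Lemma omegaE i j : delta i != 0 -> omega (scoroot i) (sroot j) = (B i j)%:~R.
Proof.
move=> di0; rewrite /omega (bigD1 i) //= (bigD1 j) //= [X in _ + X]big1.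
  rewrite addr0 [X in _ + X]big1 ?addr0; last first.
    move=> k kj; rewrite /coef /sroot !ffunE (eq_sym j) (negbTE kj).
    by rewrite mulr0.
  rewrite /coef /scoroot /sroot !ffunE !eqxx mulr1 /GRing.scale /= mulr1.
  by rewrite mulrAC divff // mul1r.
move=> k ki; apply: big1 => l _; rewrite /coef /scoroot /sroot !ffunE.
by rewrite (eq_sym i) (negbTE ki) /GRing.scale /= mulr0 mulr0 mul0r.
Qed.

Definition label_set (G : quasi_graph) (C : qvert G -> qedge G -> rootspace)
    (v : qvert G) : {fset rootspace} :=
  [fset C v e | e in inc v]%fset.

(* [lab v e] and [colab v e] are C(v,e) and its co-label; they are used only for
   [e \in inc v]. *)
Record framework := Framework {
  fgraph :> quasi_graph;
  lab : qvert fgraph -> qedge fgraph -> rootspace;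
  colab : qvert fgraph -> qedge fgraph -> rootspace;
  base : qvert fgraph;
  fconnected : qconnected fgraph;
  fregular : qregular fgraph #|I|;
  colabP : forall v e, e \in inc v ->
    exists2 c : R, 0 < c & colab v e = c *: lab v e;
  lab_sign : forall v e, e \in inc v ->
    lab v e != 0 /\ (nonneg (lab v e) || nonneg (- lab v e));
  base_lab : label_set lab base = [fset sroot i | i : I]%fset;
  base_colab : label_set colab base = [fset scoroot i | i : I]%fset;
  lab_opp : forall v v' e, joins e v v' -> lab v' e = - lab v e;
  colab_opp : forall v v' e, joins e v v' -> colab v' e = - colab v e;
  lab_transition : forall v v' e f, joins e v v' -> f \in inc v ->
    lab v f != lab v e ->
    lab v f + pospart (vsgn (lab v e) * omega (colab v e) (lab v f)) *: lab v e
      \in label_set lab v';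
  colab_transition : forall v v' e f, joins e v v' -> f \in inc v ->
    lab v f != lab v e ->
    colab v f
      + pospart (- vsgn (colab v e) * omega (colab v f) (lab v e)) *: colab v e
      \in label_set colab v' }.

Section Theory.
Variable F : framework.
Implicit Types (v : qvert F) (e f : qedge F).

Definition mu v v' e f : qedge F :=
  if f == e then e else
  odflt f (omap val [pick f' : inc v' |
    lab v' (val f') == lab v f
      + pospart (vsgn (lab v e) * omega (colab v e) (lab v f)) *: lab v e]).

Lemma base_edge_exists i :
  exists e, (e \in inc (base F)) && (lab (base F) e == sroot i).
Proof.
have: sroot i \in label_set (@lab F) (base F).
  by rewrite base_lab; apply/imfsetP; exists i.
by case/imfsetP => e /= e_b ->; exists e; rewrite e_b eqxx.
Qed.

Definition base_edge (i : I) : qedge F := xchoose (base_edge_exists i).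

(* The seed at (u_0, ..., u_k) has index set I(u_k); it is stored as a seed with
   index set I together with the transported identification of I with I(u_k),
   the composite of the mu's along the walk. *)
Definition seed_step (st : qvert F * (I -> qedge F) * seed I) (v' : qvert F) :
    qvert F * (I -> qedge F) * seed I :=
  let: (v, lbl, sd) := st in
  if edge_of v v' is Some e then
    (v', fun i => mu v v' e (lbl i),
     if [pick k | lbl k == e] is Some k then mutate sd k else sd)
  else st.

Definition cover_seed (p : seq (qvert F)) : unlabeled_seed I :=
  unlabel (foldl seed_step (base F, base_edge, init_seed B) p).2.

Definition ample : Prop := forall p q : seq (qvert F),
  cover_vertex (base F) p -> cover_vertex (base F) q ->
  last (base F) p = last (base F) q -> cover_seed p = cover_seed q.

Definition injective_framework : Prop := forall u v : qvert F,
  (label_set (@lab F) u = label_set (@lab F) v <-> u = v) /\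
  (label_set (@colab F) u = label_set (@colab F) v <-> u = v).

Definition exact_framework : Prop := injective_framework /\ ample.

Definition complete_framework : Prop := no_half_edge F.

(* The seed of an arbitrary vertex of the cover above v; by [Seed_last] this is
   the map induced by [cover_seed] when the framework is ample. *)
Definition Seed (v : qvert F) : unlabeled_seed I :=
  cover_seed (xchoose (cover_surj (base F) (@fconnected F) v)).

Lemma Seed_last (p : seq (qvert F)) : ample -> cover_vertex (base F) p ->
  Seed (last (base F) p) = cover_seed p.
Proof.
move=> amp cp; rewrite /Seed.
have /andP[cq /eqP lq] :=
  xchooseP (cover_surj (base F) (@fconnected F) (last (base F) p)).
exact: amp.
Qed.

End Theory.
End RootSpace.

Arguments Seed {R I B delta} F v.

(* Main.v *)
(* Along every walk of the framework the labels are the c-vectors of the seed,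
   and the exchange matrix is b_ij = omega(colabel_i, label_j): with the sign of
   the label of the crossed edge, the transition rules for labels and co-labels
   are exactly the mutation rules.  Co-labels stay matched with labels because
   the labels at a vertex remain linearly independent.  Hence a seed determines
   the label set of its vertex, which gives injectivity.  Backtracking along the
   last edge of a walk undoes a mutation, provided that the exchange polynomials
   do not vanish; they are ratios of polynomials positive at (1, ..., 1). *)
Require Import Defs.
From mathcomp Require Import all_boot all_order all_algebra.
From mathcomp Require Import fingroup perm fraction finmap.
From mathcomp Require Import mpoly ring lra.

Set Implicit Arguments.
Unset Strict Implicit.
Unset Printing Implicit Defensive.

Import Order.TTheory GRing.Theory Num.Theory.

Local Open Scope ring_scope.

(** * Positive parts and signs in an ordered ring *)

Section Pospart.
Variable R : realDomainType.
Implicit Types a b c x : R.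

Lemma ge0_pospart x : 0 <= x -> pospart x = x.
Proof. by rewrite /pospart => x0; apply/max_idPl. Qed.

Lemma le0_pospart x : x <= 0 -> pospart x = 0.
Proof. by rewrite /pospart => x0; apply/max_idPr. Qed.

Lemma pospart_pMl c x : 0 <= c -> pospart (c * x) = c * pospart x.
Proof. by move=> c0; rewrite /pospart maxr_pMr // mulr0. Qed.

Lemma sg_pospartM c b : 0 <= c -> Num.sg c * pospart (c * b) = c * pospart b.
Proof.
rewrite le_eqVlt => /predU1P[<-|c0]; first by rewrite sgr0 !mul0r.
by rewrite gtr0_sg // mul1r pospart_pMl // ltW.
Qed.

Lemma sg_pospartNM c b :
  c <= 0 -> Num.sg c * pospart (c * b) = c * pospart (- b).
Proof.
rewrite -oppr_ge0 => /(sg_pospartM (- b)).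
by rewrite mulrNN sgrN !mulNr => /oppr_inj.
Qed.

(* The matrix mutation rule does not depend on the choice of the sign [e]. *)
Lemma mutation_signE e a b : e = 1 \/ e = - 1 ->
  pospart (- e * a) * b + pospart (e * b) * a = Num.sg a * pospart (a * b).
Proof.
move=> he; have [a0|a0] := leP 0 a; last have {}a0 := ltW a0.
  rewrite sg_pospartM //; case: he => ->; rewrite ?opprK ?mulN1r ?mul1r.
    by rewrite (le0_pospart (x := - a)) ?oppr_le0 //; ring.
  rewrite (ge0_pospart a0); have [b0|/ltW b0] := leP 0 b.
    by rewrite (ge0_pospart b0) le0_pospart ?oppr_le0 //; ring.
  by rewrite (le0_pospart b0) ge0_pospart ?oppr_ge0 //; ring.
rewrite sg_pospartNM //; case: he => ->; rewrite ?opprK ?mulN1r ?mul1r.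
  rewrite ge0_pospart ?oppr_ge0 //; have [b0|/ltW b0] := leP 0 b.
    by rewrite (ge0_pospart b0) le0_pospart ?oppr_le0 //; ring.
  by rewrite (le0_pospart b0) ge0_pospart ?oppr_ge0 //; ring.
by rewrite (le0_pospart a0); ring.
Qed.

End Pospart.

Lemma pospart_intr (R : realDomainType) (z : int) :
  (pospart z)%:~R = pospart (z%:~R : R).
Proof.
have [z0|/ltW z0] := leP 0 z; first by rewrite !ge0_pospart ?ler0z.
by rewrite !le0_pospart ?lerz0.
Qed.

(** * Nonvanishing of rational functions by evaluation at a positive point *)

Section PositiveFractions.
Variable I : finType.
Implicit Types x y : ambient I.

(** A stand-in for subtraction-free expressions: this class contains the generators, is closed under
    sums, products and inverses, and excludes zero. *)
Definition ratio_pos x : Prop :=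
  exists p q : {mpoly rat[#|{: I + I}|]},
    [/\ 0 < p.@[fun=> 1], 0 < q.@[fun=> 1]
      & x = FracField.tofrac p / FracField.tofrac q].

Lemma meval_neq0 (p : {mpoly rat[#|{: I + I}|]}) :
  0 < p.@[fun=> 1] -> FracField.tofrac p != 0.
Proof.
by apply: contraTneq => /eqP; rewrite tofrac_eq0 => /eqP->;
  rewrite meval0 ltxx.
Qed.

Lemma ratio_pos_neq0 x : ratio_pos x -> x != 0.
Proof.
by case=> p [q [p0 q0 ->]]; rewrite mulf_neq0 ?invr_eq0 ?meval_neq0.
Qed.

Lemma ratio_pos1 : ratio_pos 1.
Proof. by exists 1, 1; rewrite meval1 tofrac1 divr1. Qed.

Lemma ratio_posM x y : ratio_pos x -> ratio_pos y -> ratio_pos (x * y).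
Proof.
case=> p [q [p0 q0 ->]] [p' [q' [p0' q0' ->]]].
exists (p * p'), (q * q'); rewrite !mevalM !mulr_gt0 //; split=> //.
by rewrite !tofracM invfM mulrACA.
Qed.

Lemma ratio_posD x y : ratio_pos x -> ratio_pos y -> ratio_pos (x + y).
Proof.
case=> p [q [p0 q0 ->]] [p' [q' [p0' q0' ->]]].
exists (p * q' + p' * q), (q * q'); split.
- by rewrite mevalD !mevalM addr_gt0 ?mulr_gt0.
- by rewrite mevalM mulr_gt0.
by rewrite tofracD !tofracM addf_div ?meval_neq0.
Qed.

Lemma ratio_posV x : ratio_pos x -> ratio_pos x^-1.
Proof.
by case=> p [q [p0 q0 ->]]; exists q, p; rewrite invf_div.
Qed.

Lemma ratio_posX x n : ratio_pos x -> ratio_pos (x ^+ n).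
Proof.
move=> x0; elim: n => [|n IHn]; first by rewrite expr0; apply: ratio_pos1.
by rewrite exprS; apply: ratio_posM.
Qed.

Lemma ratio_posXz x (z : int) : ratio_pos x -> ratio_pos (x ^ z).
Proof.
by move=> x0; case: z => n; [|apply: ratio_posV]; apply: ratio_posX.
Qed.

Lemma ratio_pos_gen (p : I + I) : ratio_pos (gen p).
Proof. by exists 'X_(enum_rank p), 1; rewrite mevalXU meval1 tofrac1 divr1. Qed.

End PositiveFractions.

(** * Mutation is an involution and commutes with relabeling *)

Section SeedMutation.
Variables (I : finType).
Implicit Types (S : seed I) (k : I) (s : {perm I}).

Definition exchange_poly S k : ambient I :=
  \prod_p seedvar S p ^ pospart (exmx S p k) +
  \prod_p seedvar S p ^ pospart (- exmx S p k).

Definition pos_cluster S : Prop := forall i, ratio_pos (cluster S i).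

Lemma cluster_mutate S k i :
  cluster (mutate S k) i =
  if i == k then (cluster S k)^-1 * exchange_poly S k else cluster S i.
Proof. by rewrite /cluster ffunE. Qed.

Lemma exmx_mutate S k p q :
  exmx (mutate S k) p q =
  if (p == inl k) || (q == k) then - exmx S p q
  else exmx S p q +
       Num.sg (exmx S p k) * pospart (exmx S p k * exmx S (inl k) q).
Proof. by rewrite /exmx ffunE. Qed.

Lemma seedP S S' : (forall i, cluster S i = cluster S' i) ->
  (forall p q, exmx S p q = exmx S' p q) -> S = S'.
Proof.
case: S S' => [x b] [x' b'] /= hx hb; congr (_, _); apply/ffunP => //.
by case=> p q; apply: hb.
Qed.

Lemma exchange_poly_pos S k : pos_cluster S -> ratio_pos (exchange_poly S k).
Proof.
move=> S0; have v0 p : ratio_pos (seedvar S p).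
  by case: p => i; [apply: S0|apply: ratio_pos_gen].
by apply: ratio_posD; elim/big_ind: _ => [|x y|p _];
  [apply: ratio_pos1|apply: ratio_posM|apply: ratio_posXz
  |apply: ratio_pos1|apply: ratio_posM|apply: ratio_posXz].
Qed.

Lemma mutate_pos S k : pos_cluster S -> pos_cluster (mutate S k).
Proof.
move=> S0 i; rewrite cluster_mutate; case: eqP => // _.
by apply: ratio_posM; [apply: ratio_posV|apply: exchange_poly_pos].
Qed.

(** Since the diagonal entry is zero, the k-th variable does not enter its own exchange polynomial.
    The second mutation thus only swaps the two monomials, and the common factor, nonzero by
    positivity, cancels. *)
Lemma mutateK S k : pos_cluster S -> exmx S (inl k) k = 0 ->
  mutate (mutate S k) k = S.
Proof.
move=> S0 bkk.
have vE p z : z = exmx S p k \/ z = - exmx S p k ->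
    seedvar (mutate S k) p ^ pospart z = seedvar S p ^ pospart z.
  case: p => i; last by move=> _; reflexivity.
  rewrite [seedvar (mutate S k) _]cluster_mutate.
  have [->|_] := eqVneq i k; last by move=> _; reflexivity.
  (* The only variable that changed carries exponent 0. *)
  by rewrite bkk oppr0 => -[] ->; rewrite /pospart maxxx !expr0z.
have bE : exchange_poly (mutate S k) k = exchange_poly S k.
  rewrite /exchange_poly addrC; congr (_ + _); apply: eq_bigr => p _.
    by rewrite exmx_mutate eqxx orbT opprK vE //; left.
  by rewrite exmx_mutate eqxx orbT vE //; right.
apply: seedP => [i|p q].
  rewrite cluster_mutate bE; case: eqP => [->|/eqP ik].
    rewrite cluster_mutate eqxx invfM invrK -mulrA mulVf ?mulr1 //.
    exact/ratio_pos_neq0/exchange_poly_pos.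
  by rewrite cluster_mutate (negbTE ik).
rewrite exmx_mutate; case: ifP => pq; rewrite !exmx_mutate pq ?opprK //.
by rewrite !eqxx orbT /= mulrNN sgrN mulNr addrK.
Qed.

Lemma mutate_relabel S s k :
  mutate (relabel s S) k = relabel s (mutate S (s k)).
Proof.
have cE T i : cluster (relabel s T) i = cluster T (s i).
  by rewrite /cluster /= ffunE.
have eE T p q : exmx (relabel s T) p q = exmx T (relabel_row s p) (s q).
  by rewrite /exmx /= ffunE.
have rowI : injective (relabel_row s).
  by move=> [i|i] [j|j] //= [] // /perm_inj->.
have vE T p : seedvar (relabel s T) p = seedvar T (relabel_row s p).
  by case: p => i //=; rewrite cE.
have bE : exchange_poly (relabel s S) k = exchange_poly S (s k).
  by rewrite /exchange_poly; congr (_ + _); rewrite [RHS](reindex_inj rowI);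
    apply: eq_bigr => p _; rewrite vE eE.
apply: seedP => [i|p q].
  by rewrite cE !cluster_mutate bE !cE (inj_eq perm_inj).
rewrite eE !exmx_mutate !eE /= (inj_eq perm_inj).
by rewrite -(inj_eq rowI p).
Qed.

(** Mutation descends to unlabeled seeds, the direction being carried along by the relabeling
    permutation. *)
Lemma seed_equiv_mutate S S' k : seed_equiv S S' ->
  exists k', seed_equiv (mutate S k') (mutate S' k).
Proof.
case/existsP=> s /eqP->; exists (s k); rewrite mutate_relabel.
by apply/existsP; exists s.
Qed.

End SeedMutation.

(** * The form omega, signs of roots and linear independence *)

Section RootSpaceTheory.
Variables (R : realFieldType) (I : finType) (B : I -> I -> int).
Variable delta : I -> R.
Implicit Types (x y z : rootspace R I) (a : R).
Local Notation omega := (omega B delta).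

Lemma coefD x y i : coef (x + y) i = coef x i + coef y i.
Proof. by rewrite /coef ffunE. Qed.

Lemma coefZ a x i : coef (a *: x) i = a * coef x i.
Proof. by rewrite /coef ffunE. Qed.

Lemma coefN x i : coef (- x) i = - coef x i.
Proof. by rewrite /coef ffunE. Qed.

Lemma omegaDl x y z : omega (x + y) z = omega x z + omega y z.
Proof.
rewrite /omega -big_split; apply: eq_bigr => i _; rewrite -big_split.
by apply: eq_bigr => j _; rewrite coefD /=; ring.
Qed.

Lemma omegaZl a x z : omega (a *: x) z = a * omega x z.
Proof.
rewrite /omega mulr_sumr; apply: eq_bigr => i _; rewrite mulr_sumr.
by apply: eq_bigr => j _; rewrite coefZ /=; ring.
Qed.

Hypothesis hB : skew_symmetrizer B delta.

Lemma omegaC x y : omega x y = - omega y x.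
Proof.
rewrite /omega exchange_big -sumrN; apply: eq_bigr => i _; rewrite -sumrN.
by apply: eq_bigr => j _; rewrite (hB.2 j i); ring.
Qed.

Lemma omegaDr x y z : omega x (y + z) = omega x y + omega x z.
Proof. by rewrite omegaC omegaDl opprD -!omegaC. Qed.

Lemma omegaZr a x y : omega x (a *: y) = a * omega x y.
Proof. by rewrite omegaC omegaZl -mulrN -omegaC. Qed.

Lemma omegaNl x y : omega (- x) y = - omega x y.
Proof. by rewrite -scaleN1r omegaZl mulN1r. Qed.

Lemma omegaNr x y : omega x (- y) = - omega x y.
Proof. by rewrite -scaleN1r omegaZr mulN1r. Qed.

Lemma omega_self x : omega x x = 0.
Proof. by have := omegaC x x; lra. Qed.

Lemma vsgn_pm1 x : vsgn x = 1 \/ vsgn x = - 1.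
Proof. by rewrite /vsgn; case: ifP; [left|right]. Qed.

Lemma vsgnZ a x : 0 < a -> vsgn (a *: x) = vsgn x.
Proof.
move=> a0; rewrite /vsgn /nonneg; congr (if _ then _ else _).
by apply: eq_forallb => i; rewrite coefZ pmulr_rge0.
Qed.

Lemma coef_signE x i (b : R) : nonneg x || nonneg (- x) ->
  Num.sg (coef x i) * pospart (coef x i * b) = pospart (vsgn x * b) * coef x i.
Proof.
rewrite /vsgn; case: ifP => [/forallP xi _|_ /= /forallP/(_ i)].
  by rewrite sg_pospartM // mul1r mulrC.
by rewrite coefN oppr_ge0 => xi; rewrite sg_pospartNM // mulN1r mulrC.
Qed.

Definition free_family (f : I -> rootspace R I) : Prop :=
  forall a : I -> R, \sum_i a i *: f i = 0 -> forall i, a i = 0.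

Lemma free_family_prop f a b i j : free_family f -> a != 0 ->
  a *: f i = b *: f j -> i = j.
Proof.
move=> fr a0 fij; apply/eqP/negPn/negP => ij.
have /fr/(_ i) : \sum_l (if l == i then a else if l == j then - b else 0) *: f l
    = 0.
  rewrite (bigD1 i) //= (bigD1 j) 1?eq_sym //= eqxx eq_sym (negbTE ij) eqxx.
  rewrite big1 ?addr0 => [|l /andP[/negbTE-> /negbTE->]]; last exact: scale0r.
  by rewrite fij scaleNr subrr.
by rewrite eqxx => /eqP; rewrite (negbTE a0).
Qed.

Lemma free_family_inj f : free_family f -> injective f.
Proof.
move=> fr i j fij; apply: (free_family_prop (a := 1) (b := 1) fr).
  exact: oner_neq0.
by rewrite fij.
Qed.

(** The change of family is invertible: a relation among the [f'] regroups into one among the [f]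
    whose coefficients away from [k] are unchanged. These vanish first, and then so does the one at
    [k]. *)
Lemma free_family_pivot f f' (m : I -> R) k : free_family f ->
  f' k = - f k -> (forall i, i != k -> f' i = f i + m i *: f k) ->
  free_family f'.
Proof.
move=> fr fk fi a sa.
have /fr a0 : \sum_i (if i == k then \sum_(j | j != k) a j * m j - a k
                      else a i) *: f i = 0.
  rewrite -[RHS]sa (bigD1 k) //= [RHS](bigD1 k) //= eqxx fk.
  rewrite scalerBl scaler_suml scalerN addrC [RHS]addrC addrA; congr (_ - _).
  rewrite -big_split; apply: eq_bigr => i ik /=.
  by rewrite (negbTE ik) fi // scalerDr scalerA.
have ai i : i != k -> a i = 0 by move=> ik; have := a0 i; rewrite (negbTE ik).
move=> i; have [->|/ai//] := eqVneq i k.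
have := a0 k; rewrite eqxx big1 => [|j /ai->]; last by rewrite mul0r.
by rewrite sub0r => /eqP; rewrite oppr_eq0 => /eqP.
Qed.

Lemma coef_sroot (i j : I) : coef (sroot R i) j = (i == j)%:R.
Proof. by rewrite /coef ffunE. Qed.

Lemma free_sroot : free_family (@sroot R I).
Proof.
move=> a sa i; have /(congr1 (fun x => coef x i)) := sa.
have coef_sum (f : I -> rootspace R I) :
    coef (\sum_l f l) i = \sum_l coef (f l) i.
  exact: sum_ffunE.
rewrite coef_sum (bigD1 i) //= coefZ coef_sroot eqxx mulr1.
rewrite big1 => [|j ji]; last by rewrite coefZ coef_sroot (negbTE ji) mulr0.
by rewrite addr0 => ->; rewrite /coef ffunE.
Qed.

End RootSpaceTheory.

(** * Full edges of a quasi-graph *)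

Lemma edge_ofE (G : quasi_graph) (e : qedge G) (u v : qvert G) :
  joins e u v -> edge_of u v = Some e.
Proof.
move=> je; have /and3P[uv eu ev] := je.
have /adjP : exists f, joins f u v by exists e.
rewrite /adj /=; case Ef: (edge_of u v) => [f|//] _.
have /and3P[_ fu fv] := edge_of_joins Ef.
by rewrite (full_edge_uniq uv fu fv eu ev).
Qed.

Lemma joinsC (G : quasi_graph) (e : qedge G) (u v : qvert G) :
  joins e u v = joins e v u.
Proof. by rewrite /joins eq_sym; congr (_ && _); rewrite andbC. Qed.

(** * Labels of a framework as c-vectors of seeds *)

Section FrameworkTheory.
Variables (R : realFieldType) (I : finType) (B : I -> I -> int).
Variables (delta : I -> R) (hB : skew_symmetrizer B delta).
Variable F : framework B delta.
Implicit Types (v : qvert F) (e f : qedge F) (lbl : I -> qedge F).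
Implicit Types (S : seed I).
Local Notation omega := (omega B delta).

(* [lbl] matches the indices of [S] with the edges at [v]. *)
Record seed_at v lbl S : Prop := SeedAt {
  lbl_inc : forall i, lbl i \in inc v;
  lab_free : free_family (fun i => lab v (lbl i));
  lab_cvec : forall i j, coef (lab v (lbl j)) i = (exmx S (inr i) j)%:~R;
  lab_exmx : forall i j,
    omega (colab v (lbl i)) (lab v (lbl j)) = (exmx S (inl i) j)%:~R;
  cluster_pos : pos_cluster S }.

(** Independence makes [lbl] injective, and regularity gives [inc v] exactly as many elements as
    [I]. *)
Lemma lbl_onto v lbl : (forall i, lbl i \in inc v) ->
  free_family (fun i => lab v (lbl i)) ->
  forall e, e \in inc v -> exists i, lbl i = e.
Proof.
move=> li fr e ev; pose g i : inc v := [` li i]%fset.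
have gI : injective g.
  by move=> i j /(congr1 val) /= gij; apply: (free_family_inj fr); rewrite gij.
have : [` ev]%fset \in codom g.
  by apply: inj_card_onto => //; rewrite -cardfE fregular.
by case/codomP => i /(congr1 val) /= ->; exists i.
Qed.

(** Co-labels are prescribed only as sets, at the base and across an edge. Proportionality to a
    label, which independence makes unambiguous, tells which edge carries a given co-label. *)
Lemma colab_unique v lbl i j (c : R) : (forall i, lbl i \in inc v) ->
  free_family (fun i => lab v (lbl i)) -> 0 < c ->
  colab v (lbl j) = c *: lab v (lbl i) -> i = j.
Proof.
move=> li fr c0; have [b b0 ->] := colabP (li j) => /esym.
by apply: (free_family_prop fr); rewrite gt_eqF.
Qed.

Lemma seed_at_base : seed_at (base F) (base_edge F) (init_seed B).
Proof.
have be i : base_edge F i \in inc (base F) /\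
    lab (base F) (base_edge F i) = sroot R i.
  by have /andP[-> /eqP->] := xchooseP (base_edge_exists F i).
have li i : base_edge F i \in inc (base F) by have [] := be i.
have lE i : lab (base F) (base_edge F i) = sroot R i by have [] := be i.
have fr : free_family (fun i => lab (base F) (base_edge F i)).
  by move=> a; under eq_bigr do rewrite lE; apply: free_sroot.
have cE i : colab (base F) (base_edge F i) = scoroot delta i.
  have : scoroot delta i \in label_set (@colab _ _ _ _ F) (base F).
    by rewrite base_colab; apply/imfsetP; exists i.
  case/imfsetP => e /= eb ce; have [j je] := lbl_onto li fr eb.
  rewrite ce -je; congr (colab _ (base_edge F _)).
  apply: (colab_unique (c := (delta i)^-1) li fr).
  - by rewrite invr_gt0; case: hB.
  by rewrite je -ce lE.
split=> // [i j|i j|i].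
- by rewrite lE coef_sroot /exmx ffunE eq_sym; case: eqP.
- by rewrite cE lE omegaE /exmx ?ffunE // gt_eqF //; case: hB.
by rewrite /cluster ffunE; apply: ratio_pos_gen.
Qed.

Lemma seed_at_diag v lbl S k : seed_at v lbl S -> exmx S (inl k) k = 0.
Proof.
move=> sv; apply/eqP; rewrite -(intr_eq0 R) -(lab_exmx sv).
have [c _ ->] := colabP (lbl_inc sv k).
by rewrite omegaZl omega_self // mulr0.
Qed.

(** The inductive step along an edge. Frozen rows follow the label rule by [coef_signE]; mutable
    rows follow from bilinearity of omega and [mutation_signE]; independence persists by
    [free_family_pivot]. *)
Lemma seed_at_mutate v v' lbl S k :
  joins (lbl k) v v' -> seed_at v lbl S ->
  seed_at v' (fun i => mu v v' (lbl k) (lbl i)) (mutate S k).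
Proof.
move=> je [li fr cvec bmat S0].
set b := lab v (lbl k); set b' := colab v (lbl k).
set lbl' := fun i => _.
have [cb cb0 cbE] := colabP (li k); rewrite -/b -/b' in cbE.
have bb0 : omega b' b = 0 by rewrite cbE omegaZl omega_self // mulr0.
have lblI : injective lbl.
  by move=> i j ij; apply: (free_family_inj fr); rewrite ij.
pose m i := pospart (vsgn b * omega b' (lab v (lbl i))).
have lab_neq i : i != k -> lab v (lbl i) != b.
  by apply: contraNneq => /(free_family_inj fr)->.
have lk : lbl' k = lbl k by rewrite /lbl' /mu eqxx.
have lab'k : lab v' (lbl' k) = - b by rewrite lk; apply: lab_opp.
have step i : i != k ->
    lbl' i \in inc v' /\ lab v' (lbl' i) = lab v (lbl i) + m i *: b.
  move=> ik; rewrite /lbl' /mu (inj_eq lblI) (negbTE ik).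
  case: pickP => [f /eqP fE|no] /=; first by split; [apply: fsvalP|exact: fE].
  (* The transition rule supplies an edge to pick, so the default value in [mu] is never reached. *)
  have /imfsetP[f /= fv' fE] := lab_transition je (li i) (lab_neq i ik).
  by have := no [` fv']%fset; rewrite /= -fE eqxx.
have li' i : lbl' i \in inc v'.
  have [->|/step[]//] := eqVneq i k.
  by rewrite lk; have /and3P[] := je.
have lab' i : i != k -> lab v' (lbl' i) = lab v (lbl i) + m i *: b.
  by case/step.
have fr' : free_family (fun i => lab v' (lbl' i)).
  exact: (free_family_pivot fr lab'k lab').
pose m' i := pospart (- vsgn b * omega (colab v (lbl i)) b).
have colab'k : colab v' (lbl' k) = - b' by rewrite lk; apply: colab_opp.
(* The transition rule places the right-hand side among the co-labels at [v']. It belongs to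
   [lbl' i] because it is [c] times the new label: skew-symmetry of omega gives
   [m' i * cb = c * m i]. *)
have colab' i : i != k -> colab v' (lbl' i) = colab v (lbl i) + m' i *: b'.
  move=> ik; have := colab_transition je (li i) (lab_neq i ik).
  rewrite -/b -/b' {1}cbE vsgnZ // -/(m' i) => /imfsetP[f /= fv' fE].
  have [j jf] := lbl_onto li' fr' fv'.
  rewrite fE -jf; congr (colab v' (lbl' _)).
  have [c c0 cE] := colabP (li i).
  apply: (colab_unique (c := c) li' fr' _) => //.
  rewrite jf -fE cE lab' // scalerDr; congr (_ + _).
  rewrite /m' /m cE omegaZl (omegaC hB _ b) cbE omegaZl.
  rewrite mulrN mulrNN [vsgn b * (c * _)]mulrCA [vsgn b * (cb * _)]mulrCA.
  rewrite (pospart_pMl _ (ltW c0)) (pospart_pMl _ (ltW cb0)) !scalerA.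
  by rewrite mulrAC mulrA.
split=> //; last exact: mutate_pos.
- move=> i j; rewrite exmx_mutate /=; have [->|jk] := eqVneq j k.
    by rewrite lab'k coefN cvec rmorphN.
  rewrite lab' // coefD coefZ cvec rmorphD rmorphM /= intr_sg pospart_intr.
  rewrite rmorphM /= -(cvec i k) -(bmat k j) -/b -/b' coef_signE //.
  by case: (lab_sign (li k)).
- move=> i j; rewrite exmx_mutate /= (inj_eq (@inl_inj _ _)).
  have [->|ik] /= := eqVneq i k.
    rewrite colab'k omegaNl rmorphN /= -bmat -/b'; congr (- _).
    have [->|jk] := eqVneq j k; first by rewrite lab'k omegaNr // -/b bb0 oppr0.
    by rewrite lab' // omegaDr // omegaZr // bb0 mulr0 addr0.
  have [->|jk] /= := eqVneq j k.
    rewrite lab'k colab' // omegaNr // omegaDl omegaZl bb0 mulr0 addr0.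
    by rewrite bmat rmorphN.
  (* The product of the two corrections vanishes with [omega b' b]; the two linear terms are the
     left side of [mutation_signE] for the sign [vsgn b]. *)
  rewrite lab' // colab' // omegaDl !omegaDr // !omegaZr // !omegaZl bb0.
  rewrite !mulr0 addr0 rmorphD rmorphM /= intr_sg pospart_intr rmorphM /=.
  rewrite -!bmat -/b -/b' -(mutation_signE _ _ (vsgn_pm1 b)) /m /m'.
  by ring.
Qed.

(** * Seeds along walks and the universal cover *)

Lemma lbl_inj v lbl S : seed_at v lbl S -> injective lbl.
Proof.
by move=> sv i j ij; apply: (free_family_inj (lab_free sv)); rewrite ij.
Qed.

Lemma seed_stepE v v' lbl S k : seed_at v lbl S -> joins (lbl k) v v' ->
  seed_step (v, lbl, S) v' =
  (v', fun i => mu v v' (lbl k) (lbl i), mutate S k).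
Proof.
move=> sv je; rewrite /seed_step (edge_ofE je).
case: pickP => [j /eqP/(lbl_inj sv)-> //|/(_ k)].
by rewrite eqxx.
Qed.

Lemma adj_lbl v v' lbl S : seed_at v lbl S -> adj v v' ->
  exists k, joins (lbl k) v v'.
Proof.
move=> sv /adjP[e je]; have /and3P[_ ev _] := je.
by have [k ke] := lbl_onto (lbl_inc sv) (lab_free sv) ev; exists k; rewrite ke.
Qed.

Definition walk_state (p : seq (qvert F)) :=
  foldl (@seed_step _ _ _ _ F) (base F, base_edge F, init_seed B) p.

Lemma walk_stateP p : path (@adj F) (base F) p -> exists lbl S,
  [/\ walk_state p = (last (base F) p, lbl, S),
      seed_at (last (base F) p) lbl S & reachable B S].
Proof.
elim/last_ind: p => [_|p v IHp].
  exists (base_edge F), (init_seed B); split=> //; first exact: seed_at_base.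
  by exists [::].
rewrite rcons_path => /andP[/IHp[lbl [S [pE sv [ks Sks]]]] av].
have [k je] := adj_lbl sv av.
exists (fun i => mu (last (base F) p) v (lbl k) (lbl i)), (mutate S k).
rewrite last_rcons /walk_state foldl_rcons -/(walk_state p) pE.
rewrite (seed_stepE sv je); split=> //; first exact: seed_at_mutate.
by exists (rcons ks k); rewrite foldl_rcons -Sks.
Qed.

Lemma cover_vertex_rcons p v :
  cover_vertex (base F) (rcons p v) ->
  cover_vertex (base F) p && adj (last (base F) p) v.
Proof.
rewrite /cover_vertex rcons_path => /andP[/andP[-> ->]] /=; rewrite andbT.
by rewrite -cats1 pairmap_cat => /cat_sorted2[].
Qed.

(** The extended walk leaves the cover only if it repeats its last edge, and an edge has at most two
    endpoints, so the walk then returns to its previous vertex. *)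
Lemma cover_vertex_extend p v : cover_vertex (base F) p ->
  adj (last (base F) p) v ->
  cover_vertex (base F) (rcons p v) \/
  exists2 q, p = rcons q (last (base F) p) & last (base F) q = v.
Proof.
case/lastP: p => [_ /= av|q w]; first by left; rewrite /cover_vertex /= av.
rewrite last_rcons => cp av.
have [Eqv|Nqv] := eqVneq (last (base F) q) v; first by right; exists q.
left; have /andP[pp sp] := cp.
rewrite /cover_vertex rcons_path pp last_rcons av.
move: sp; rewrite -!cats1 -catA !pairmap_cat /=.
have sorted_cat2 (T : Type) (r : rel T) s a b :
    sorted r (s ++ [:: a; b]) = sorted r (s ++ [:: a]) && r a b.
  by case: s => [|x s] /=; rewrite ?andbT // !cat_path /= !andbT andbA.
rewrite sorted_cat2 => -> /=; apply/eqP => E.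
case/adjP: av => e je; have := edge_ofE je; rewrite -E => /edge_of_joins jq.
have /and3P[qw eq_ ew] := jq; have /and3P[wv _ ev] := je.
have := edge_size_le2 eq_ ew ev.
by rewrite (negbTE qw) (negbTE wv) (negbTE Nqv).
Qed.

(** * The induced map on vertices of the framework *)

Hypothesis amp : ample F.

(** One labeled representative serves all full edges at [v]. Take the end of a cover walk to [v]:
    crossing an edge either extends the walk, or undoes its last step, where [mutateK] applies. *)
Lemma vertex_seedP v : exists lbl S,
  [/\ seed_at v lbl S, reachable B S, Seed F v = unlabel S &
      forall k v', joins (lbl k) v v' -> Seed F v' = unlabel (mutate S k)].
Proof.
have [p /andP[cp /eqP lp]] := cover_surj (base F) (@fconnected _ _ _ _ F) v.
have /andP[pp _] := cp; have [lbl [S [pE]]] := walk_stateP pp.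
rewrite lp in pE * => sv rS; exists lbl, S; split=> //.
  by rewrite -lp Seed_last // /cover_seed -/(walk_state p) pE.
move=> k v' je; have av : adj (last (base F) p) v'.
  by rewrite lp; apply/adjP; exists (lbl k).
have [cp'|[q]] := cover_vertex_extend cp av.
  rewrite -[v'](last_rcons (base F) p) Seed_last // /cover_seed foldl_rcons.
  by rewrite -/(walk_state p) pE (seed_stepE sv je).
rewrite lp => pq lq; move: cp; rewrite pq => /cover_vertex_rcons/andP[cq].
rewrite lq => avv; have /andP[pq' _] := cq.
have [lblq [Sq [qE svq _]]] := walk_stateP pq'; rewrite lq in qE svq.
have [j jeq] := adj_lbl svq avv.
move: pE; rewrite pq /walk_state foldl_rcons -/(walk_state q) qE.
rewrite (seed_stepE svq jeq) => -[lblE SE].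
(* [mu] fixes the crossed edge, and only one full edge joins [v] and [v']. *)
have jk : j = k.
  have lj : lbl j = lblq j by rewrite -lblE /mu eqxx.
  rewrite joinsC in jeq; apply: (lbl_inj sv); rewrite lj.
  by have := edge_ofE je; rewrite (edge_ofE jeq) => -[].
rewrite -SE -jk mutateK; last 2 first.
- exact: cluster_pos svq.
- exact: seed_at_diag svq.
by rewrite -lq Seed_last // /cover_seed -/(walk_state q) qE.
Qed.

Lemma label_set_sub u v lbl lbl' S S' :
  seed_at u lbl S -> seed_at v lbl' S' -> seed_equiv S S' ->
  {subset label_set (@lab _ _ _ _ F) v <= label_set (@lab _ _ _ _ F) u}.
Proof.
move=> su sv /existsP[s /eqP SE] x /imfsetP[e /= ev ->].
have [j <-] := lbl_onto (lbl_inc sv) (lab_free sv) ev.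
apply/imfsetP; exists (lbl (s j)); first exact: lbl_inc su _.
apply/ffunP => i; have := lab_cvec sv i j; rewrite SE /exmx ffunE /=.
by have := lab_cvec su i (s j); rewrite /exmx /coef => -> ->.
Qed.

Hypothesis inj : injective_framework F.

Lemma Seed_inj : injective (Seed F).
Proof.
move=> u v; have [lbl [S [su _ -> _]]] := vertex_seedP u.
have [lbl' [S' [sv _ -> _]]] := vertex_seedP v.
move=> /unlabelP SS'; apply/(inj u v).1/fsetP => x; apply/idP/idP.
  by apply: (label_set_sub sv su); rewrite seed_equiv_sym.
exact: label_set_sub su sv SS' x.
Qed.

Lemma Seed_adj u v : adj u v -> gedge (exchange_graph B) (Seed F u) (Seed F v).
Proof.
have [lbl [S [su rS -> Sk]]] := vertex_seedP u.
by case/(adj_lbl su) => k je; exists S, k; rewrite (Sk k).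
Qed.

Hypothesis compl : complete_framework F.

(** Without half-edges every mutation direction is realized by crossing a full edge. [S] may be any
    representative, its direction [k] being transported by [seed_equiv_mutate]. *)
Lemma Seed_mutate u S k : Seed F u = unlabel S ->
  exists2 v, adj u v & Seed F v = unlabel (mutate S k).
Proof.
have [lbl [S' [su _ -> Sk]]] := vertex_seedP u.
move/unlabelP/(seed_equiv_mutate k) => [k' /unlabelP <-].
have [v je] := compl (lbl_inc su k').
by exists v; [apply/adjP; exists (lbl k')|apply: Sk].
Qed.

Lemma Seed_onto S : reachable B S -> exists v, Seed F v = unlabel S.
Proof.
case=> ks ->; elim/last_ind: ks => [|ks k [u uE]].
  by exists (base F); apply: (@Seed_last _ _ _ _ F [::] amp).
by rewrite foldl_rcons; have [v _ <-] := Seed_mutate k uE; exists v.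
Qed.

End FrameworkTheory.

Theorem theorem4p2 (R : realFieldType) (I : finType) (B : I -> I -> int)
    (delta : I -> R) (hB : skew_symmetrizer B delta)
    (F : framework B delta) (hF : exact_framework F) :
  [/\ subgraph (graph_image (Seed F) (full_graph F))
        (exchange_graph B),
      graph_iso (Seed F) (full_graph F)
        (graph_image (Seed F) (full_graph F)) &
      complete_framework F ->
        graph_iso (Seed F) (full_graph F) (exchange_graph B)].
Proof.
have [inj amp] := hF; have SeedI := Seed_inj hB amp inj.
have SeedV u : gvertex (exchange_graph B) (Seed F u).
  by have [_ [S [_ rS uS _]]] := vertex_seedP hB amp u; exists S.
split.
- split=> [_ [u _ ->] //|_ _ [u [v [uv -> ->]]]].
  exact: Seed_adj.
- split=> [u _|u v _ _ /SeedI //|_ [u _ ->]|u v _ _]; try by exists u.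
  (* An edge of the image comes from an edge of the framework, whose endpoints injectivity
     identifies. *)
  split=> [uv|[u' [v' [uv /SeedI-> /SeedI->]]] //].
  by exists u, v.
move=> compl; split=> [u _ //|u v _ _ /SeedI //|_ [S rS ->]|u v _ _].
  by have [v] := Seed_onto hB amp compl rS; exists v.
split=> [|[S [k [_ uS vS]]]]; first exact: Seed_adj.
(* The mutation is realized by some neighbor [w] of [u]; it has the same seed as [v], hence equals
   [v]. *)
have [w uw] := Seed_mutate hB amp compl k uS.
by rewrite -vS => /SeedI <-.
Qed.
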